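(* Let $n\ge 2$ and let $y=(y_1,\dots,y_n)^T\in\mathbb{R}^n$. Let $y_{(1)}\le y_{(2)}\le\cdots\le y_{(n)}$ denote the components of $y$ sorted in ascending order, and for $i=0,1,\dots,n-1$ define $$t_i:=\frac{\left(\sum_{j=i+1}^n y_{(j)}\right)-1}{n-i}.$$ Say that $t_0$ falls into its corresponding interval if $t_0\le y_{(1)}$, and that, for $1\le i\le n-1$, $t_i$ falls into its corresponding interval if $y_{(i)}\le t_i\le y_{(i+1)}$. Then there is exactly one real number $\hat t$ in the set $\{t_i : i=0,\dots,n-1\}$ that falls into its corresponding interval (that is, exactly one real number $\hat t$ such that $\hat t=t_i$ for some $i\in\{0,\dots,n-1\}$ for which $t_i$ falls into its corresponding interval), and the projection of $y$ onto the simplex $\triangle^n$, i.e. the unique minimizer of $\|x-y\|$ over $x\in\triangle^n$, is $$x=(y-\hat t)_+ .$$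
   Context: $\|\cdot\|$ is the Euclidean norm on $\mathbb{R}^n$. The canonical simplex is $$\triangle^n=\left\{x=(x_1,\dots,x_n)^T\in\mathbb{R}^n: 0\le x_i\le 1 \text{ for } i=1,\dots,n,\ \text{ and } \sum_{i=1}^n x_i=1\right\}.$$ For a real number $t$, $(y-t)_+$ denotes the vector in $\mathbb{R}^n$ whose $i$-th component is $\max\{y_i-t,0\}$. *)

(* Defs.v *)
From mathcomp Require Import all_boot all_order all_algebra.
From mathcomp Require Import classical_sets reals.
Set Implicit Arguments.
Unset Strict Implicit.
Unset Printing Implicit Defensive.
Import Order.TTheory GRing.Theory Num.Theory.
Local Open Scope ring_scope.
Local Open Scope classical_set_scope.

(* MathComp-Analysis equips matrices with the sup norm, so the Euclidean norm
   is defined explicitly. *)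
Definition enorm (R : realType) (n : nat) (x : 'cV[R]_n) : R :=
  Num.sqrt (\sum_(i < n) x i 0 ^+ 2).

Definition simplex (R : realType) (n : nat) : set 'cV[R]_n :=
  [set x | (forall i, 0 <= x i 0 <= 1) /\ \sum_(i < n) x i 0 = 1].
Arguments simplex : clear implicits.

Definition is_minimizer (R : realType) (T : Type) (f : T -> R) (C : set T)
    (x : T) : Prop :=
  C x /\ forall z, C z -> f x <= f z.

Definition is_projection (R : realType) (n : nat) (C : set 'cV[R]_n)
    (y x : 'cV[R]_n) : Prop :=
  unique (is_minimizer (fun z => enorm (z - y)) C) x.

(* (y - t)_+ *)
Definition pos_shift (R : realType) (n : nat) (y : 'cV[R]_n) (t : R) :
    'cV[R]_n :=
  \col_i Num.max (y i 0 - t) 0.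

(* y_(j), with j ranging over 1, ..., n; other values of j are never used. *)
Definition order_stat (R : realType) (n : nat) (y : 'cV[R]_n) (j : nat) : R :=
  nth 0 (sort <=%R [seq y i 0 | i : 'I_n]) j.-1.

Definition tcand (R : realType) (n : nat) (y : 'cV[R]_n) (i : nat) : R :=
  ((\sum_(i.+1 <= j < n.+1) order_stat y j) - 1) / (n - i)%:R.

Definition falls_in_interval (R : realType) (n : nat) (y : 'cV[R]_n)
    (i : nat) : Prop :=
  if i is 0%N then tcand y 0 <= order_stat y 1
  else order_stat y i <= tcand y i <= order_stat y i.+1.

(* Main.v *)
Require Import Defs.
From mathcomp Require Import all_boot all_order all_algebra.
From mathcomp Require Import classical_sets reals.
From mathcomp Require Import ring lra.
Import Order.TTheory GRing.Theory Num.Theory.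
Local Open Scope ring_scope.

(** The map [t |-> \sum_i max(y_i - t, 0)] is strictly decreasing wherever it is
    positive, so it takes the value 1 at most once, and a candidate falling into
    its interval is a solution. The least [i] with [t_i <= y_(i+1)] yields
    such a candidate. Comparing squared distances coordinatewise shows that
    [(y - t)_+] is the projection as soon as its components sum to 1. *)

Lemma size_order_stat {R : realType} {n : nat} (y : 'cV[R]_n) :
  size (sort <=%R [seq y i 0 | i : 'I_n]) = n.
Proof. by rewrite size_sort size_image card_ord. Qed.

Lemma sum_order_stat {R : realType} {n : nat} (y : 'cV[R]_n) (f : R -> R) :
  \sum_(1 <= j < n.+1) f (order_stat y j) = \sum_(i < n) f (y i 0).
Proof.
rewrite big_add1 /= -[X in \sum_(0 <= j < X) _](size_order_stat y).
rewrite -(big_nth 0 xpredT f).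
by rewrite (perm_big _ (introT permPl (perm_sort _ _))) big_image.
Qed.

Lemma order_stat_le {R : realType} {n : nat} (y : 'cV[R]_n) (j k : nat) :
  (0 < j)%N -> (j <= k)%N -> (k <= n)%N -> order_stat y j <= order_stat y k.
Proof.
move=> j0 jk kn; have k0 := leq_trans j0 jk.
apply: (sorted_leq_nth le_trans lexx 0 (sort_le_sorted _));
  by rewrite ?inE ?size_order_stat ?prednK ?(leq_trans jk) // -ltnS !prednK.
Qed.

Lemma tcand_mul {R : realType} {n : nat} (y : 'cV[R]_n) (i : nat) :
  (i < n)%N ->
  tcand y i * (n - i)%:R = \sum_(i.+1 <= j < n.+1) order_stat y j - 1.
Proof. by move=> lt_in; rewrite divfK // pnatr_eq0 subn_eq0 -ltnNge. Qed.

(** Minimality of the index supplies the lower end of its interval, because consecutive candidates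
    are linked by a weighted average. *)
Lemma falls_in_interval_exists {R : realType} {n : nat} (y : 'cV[R]_n) :
  (0 < n)%N -> exists2 i, (i < n)%N & falls_in_interval y i.
Proof.
case: n y => // n y _.
have exP : exists i, (i < n.+1)%N && (tcand y i <= order_stat y i.+1).
  (* At the last index the sum has one term, so the candidate is the largest entry minus 1. *)
  exists n; rewrite ltnSn /=.
  have := tcand_mul y n (ltnSn n); rewrite big_nat1 subSnn mulr1 => ->.
  by rewrite gerBl.
case: (ex_minnP exP) => [[|i]] /andP[lt_in le_t] min_i; first by exists 0%N.
exists i.+1 => //=; rewrite le_t andbT.
have : order_stat y i.+1 < tcand y i.
  rewrite ltNge; apply/negP => le_ti.
  by have := min_i i; rewrite (ltnW lt_in) le_ti ltnn => /(_ isT).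
have n_i0 : 0 < (n.+1 - i.+1)%:R :> R by rewrite ltr0n subn_gt0.
(* [tcand y i] averages [order_stat y i.+1] (weight 1) and [tcand y i.+1] (weight [n.+1 - i.+1]). As
   it exceeds the former, so does the latter. *)
have := tcand_mul y _ (ltnW lt_in); have := tcand_mul y _ lt_in.
rewrite (big_ltn (m := i.+1)) 1?ltnW // -(@subnSK i n.+1) ?(ltnW lt_in) //.
rewrite -natr1 => Et Et' lt_s.
rewrite -(ler_pM2r n_i0) Et; nra.
Qed.

(** The interval separates the sorted entries: the first [i] contribute 0, the other [n - i]
    contribute [order_stat y j - t], and the definition of [tcand] makes the total 1. *)
Lemma falls_in_interval_sum {R : realType} {n : nat} (y : 'cV[R]_n) (i : nat) :
  (i < n)%N -> falls_in_interval y i ->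
  \sum_k pos_shift y (tcand y i) k 0 = 1.
Proof.
move=> lt_in fall; set t := tcand y i.
have le_t : t <= order_stat y i.+1.
  by case: (i) @t fall => [|k] //= /andP[].
(* For [i = 0] no [j] qualifies, which matches the missing lower bound. *)
have ge_t j : (0 < j)%N -> (j <= i)%N -> order_stat y j <= t.
  move=> j0 ji; have i0 := leq_trans j0 ji.
  apply: le_trans (order_stat_le y j i j0 ji (ltnW lt_in)) _.
  by rewrite /t; case: (i) i0 fall => [|k] //= _ /andP[].
under eq_bigr do rewrite mxE.
rewrite -(sum_order_stat y (fun x => Num.max (x - t) 0)).
rewrite (big_cat_nat (n := i.+1)) //= ?ltnS ?(ltnW lt_in) //.
rewrite big_nat big1 ?add0r => [|j /andP[j0 ji]]; last first.
  by apply/max_idPr; rewrite subr_le0 ge_t.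
under eq_big_nat => j /andP[ij jn].
  rewrite (max_idPl _); last first.
    by rewrite subr_ge0 (le_trans le_t) // order_stat_le.
  over.
rewrite sumrB sumr_const_nat subSS -mulr_natr tcand_mul //; ring.
Qed.

(** A positive sum forces some entry above [u]; its term drops strictly from [t] to [u], and no
    other term grows. *)
Lemma pos_shift_sum_lt {R : realType} {n : nat} (y : 'cV[R]_n) (t u : R) :
  t < u -> 0 < \sum_k pos_shift y u k 0 ->
  \sum_k pos_shift y u k 0 < \sum_k pos_shift y t k 0.
Proof.
move=> tu pos_u.
have [k yk] : exists k, u < y k 0.
  apply/existsP; apply: contraLR pos_u; rewrite negb_exists => /forallP le_yu.
  rewrite -leNgt big1 // => k _; rewrite mxE.
  by apply/max_idPr; rewrite subr_le0 leNgt.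
rewrite (bigD1 k) // [ltRHS](bigD1 k) //= !mxE.
apply: ltr_leD; first by rewrite !(max_idPl _) ?subr_ge0; lra.
apply: ler_sum => j _; rewrite !mxE.
by case: (leP (y j 0 - u) 0); case: (leP (y j 0 - t) 0); lra.
Qed.

Lemma pos_shift_sum_inj {R : realType} {n : nat} (y : 'cV[R]_n) (t u : R) :
  \sum_k pos_shift y t k 0 = 1 -> \sum_k pos_shift y u k 0 = 1 -> t = u.
Proof.
move=> sum_t sum_u; apply/eqP; case: (ltgtP t u) => // lt_tu;
  have := pos_shift_sum_lt y _ _ lt_tu;
  by rewrite sum_t sum_u ltxx ltr01 => /(_ isT).
Qed.

Lemma pos_shift_simplex {R : realType} {n : nat} (y : 'cV[R]_n) (t : R) :
  \sum_k pos_shift y t k 0 = 1 -> simplex R n (pos_shift y t).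
Proof.
have ge0 i : 0 <= pos_shift y t i 0 by rewrite mxE le_max lexx orbT.
move=> sum_x; split=> // i; rewrite ge0 -sum_x (bigD1 i) //= lerDl.
exact: sumr_ge0.
Qed.

(** The variational inequality [<z - x, x - y> >= 0] at [x = (y - t)_+]: as
    [x - y + t] is nonnegative and vanishes where [x] is positive, replacing
    [x - y] by [-t] can only decrease each term, and these sum to 0. *)
Lemma pos_shift_pythagoras {R : realType} {n : nat} (y z : 'cV[R]_n) (t : R) :
  let x := pos_shift y t in
  \sum_k x k 0 = 1 -> simplex R n z ->
  \sum_i (x - y) i 0 ^+ 2 + \sum_i (z - x) i 0 ^+ 2
    <= \sum_i (z - y) i 0 ^+ 2.
Proof.
move=> x sum_x [z01 sum_z].
have sum0 : \sum_i t *+ 2 * (z i 0 - x i 0) = 0.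
  by rewrite -mulr_sumr sumrB sum_x sum_z subrr mulr0.
(* With this null sum added, the two sides differ by [2 (z_i - x_i) (x_i - y_i + t)] in each
   coordinate. *)
rewrite -[leRHS]addr0 -[X in _ <= _ + X]sum0 -!big_split /=.
apply: ler_sum => i _; have /andP[z0 _] := z01 i; rewrite !mxE.
by case: (leP (y i 0 - t) 0) => ?; nra.
Qed.

Lemma pos_shift_projection {R : realType} {n : nat} (y : 'cV[R]_n) (t : R) :
  \sum_k pos_shift y t k 0 = 1 ->
  is_projection (simplex R n) y (pos_shift y t).
Proof.
move=> sum_x; set x := pos_shift y t.
have sq_ge0 (v : 'cV[R]_n) : 0 <= \sum_i v i 0 ^+ 2.
  by apply: sumr_ge0 => i _; exact: sqr_ge0.
have Cx : simplex R n x by exact: pos_shift_simplex.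
split=> [|z [Cz min_z]].
  split=> // z Cz; rewrite ler_sqrt ?sq_ge0 //.
  apply: le_trans (pos_shift_pythagoras y z t sum_x Cz).
  by rewrite lerDl sq_ge0.
(* A second minimizer [z] is no farther from [y] than [x], so the inequality leaves no room for
   [z - x]. *)
have := min_z x Cx; rewrite ler_sqrt ?sq_ge0 // => le_zx.
have := le_trans (pos_shift_pythagoras y z t sum_x Cz) le_zx.
rewrite gerDl => le0.
have /psumr_eq0P zx0 : \sum_i (z - x) i 0 ^+ 2 = 0.
  by apply/eqP; rewrite eq_le le0 sq_ge0.
apply/esym/eqP; rewrite -subr_eq0; apply/eqP/matrixP => i j.
rewrite (ord1 j) [RHS]mxE; apply/eqP; rewrite -sqrf_eq0 zx0 // => k _.
exact: sqr_ge0.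
Qed.

Theorem theorem2p2 (R : realType) (n : nat) (hn : (2 <= n)%N) (y : 'cV[R]_n) :
  exists that : R,
    unique (fun t : R => exists i : nat,
              [/\ (i < n)%N, t = tcand y i & falls_in_interval y i]) that
    /\ is_projection (simplex R n) y (pos_shift y that).
Proof.
have [i lt_in fall_i] := falls_in_interval_exists y (ltnW hn).
have sum_i := falls_in_interval_sum y i lt_in fall_i.
exists (tcand y i); split; last exact: pos_shift_projection.
split=> [|_ [j [lt_jn -> fall_j]]]; first by exists i.
(* With [t_i = y_(i+1)] two indices can qualify, so the values are compared, not the indices. *)
exact: pos_shift_sum_inj sum_i (falls_in_interval_sum y j lt_jn fall_j).
Qed.
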